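(* There exists an arithmetic term $T(n)$ in one variable $n$ such that (1) for all $n \in \mathbb{N}$, $T(n) \mid n$; and (2) if $n$ is composite, then $1 < T(n) < n$.
   Context: $\mathbb{N}$ includes $0$. Arithmetic terms are the expressions, interpreted as functions on $\mathbb{N}$, defined inductively: the constants $0$, $1$ and the variables are arithmetic terms; if $t_1, t_2$ are arithmetic terms, then so are $(t_1 + t_2)$, $(t_1 \mathbin{\dot{-}} t_2)$, $(t_1 * t_2)$, $(t_1 / t_2)$ and $2^{t_1}$. Here $a \mathbin{\dot{-}} b = \max(a-b, 0)$ and $a/b = \lfloor a/b \rfloor$ is the quotient of integer division, with $a/0 := 0$. A natural number $n$ is composite if $n>1$ and $n$ is not prime. *)

(* Defs.v *)
From mathcomp Require Import all_boot.

Set Implicit Arguments.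
Unset Strict Implicit.
Unset Printing Implicit Defensive.

(* Arithmetic terms in k variables, the variables being indexed by 'I_k. *)
Inductive aterm (k : nat) : Type :=
| AZero
| AOne
| AVar of 'I_k
| AAdd of aterm k & aterm k
| AMonus of aterm k & aterm k
| AMul of aterm k & aterm k
| ADiv of aterm k & aterm k
| AExp2 of aterm k.

(* ssrnat's subtraction is truncated, and m %/ 0 = 0. *)
Fixpoint aeval (k : nat) (v : 'I_k -> nat) (t : aterm k) : nat :=
  match t with
  | AZero => 0
  | AOne => 1
  | AVar i => v i
  | AAdd t1 t2 => aeval v t1 + aeval v t2
  | AMonus t1 t2 => aeval v t1 - aeval v t2
  | AMul t1 t2 => aeval v t1 * aeval v t2
  | ADiv t1 t2 => aeval v t1 %/ aeval v t2
  | AExp2 t1 => 2 ^ aeval v t1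
  end.

Definition aeval1 (t : aterm 1) (n : nat) : nat := aeval (fun=> n) t.

Definition composite (n : nat) : bool := (1 < n) && ~~ prime n.

(* Main.v *)
Require Import Defs.
From mathcomp Require Import all_boot zify.

Set Implicit Arguments.
Unset Strict Implicit.
Unset Printing Implicit Defensive.

(* For n > 1 the term computes the least prime factor of n.
   Put M = n + 1.  The triples (x, y, z) with 2 <= x <= n, y <= n and z < 2 ^ M
   such that z + 2 ^ M * x * y < 2 ^ M * n + 2 ^ x number
     2 ^ M * #{(x, y) | x * y < n} + \sum_(x | n, 2 <= x) 2 ^ x,
   whose 2-adic valuation is the least divisor x >= 2 of n.
   To count them by a term, write one digit per triple, namely 2 ^ q plus the
   (signed) slack of the inequality, in a number X, and the digit 2 ^ q
   everywhere in a number Y.  Adding X and Y produces one carry per solution,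
   so by Kummer the count is the 2-adic valuation of 'C(X + Y, X).  X and Y are
   terms because they are arithmetico-geometric sums, binomials are digits of
   (1 + 2 ^ w) ^ a, and valuations come from gcdn a (2 ^ a), where a gcd is read
   off as the number of lattice points on the diagonal of a rectangle. *)

(** * Closure properties of the functions computed by terms *)

Definition arith (f : nat -> nat) : Prop :=
  exists t : aterm 1, forall n, aeval1 t n = f n.

Lemma arith_ext f g : arith f -> f =1 g -> arith g.
Proof. by move=> [t ft] fg; exists t => n; rewrite ft fg. Qed.

Lemma arith_id : arith id.
Proof. by exists (AVar ord0). Qed.

Lemma arithD f g : arith f -> arith g -> arith (fun n => f n + g n).
Proof.
by move=> [t ft] [u gu]; exists (AAdd t u) => n; rewrite -ft -gu.
Qed.

Lemma arithB f g : arith f -> arith g -> arith (fun n => f n - g n).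
Proof.
by move=> [t ft] [u gu]; exists (AMonus t u) => n; rewrite -ft -gu.
Qed.

Lemma arithM f g : arith f -> arith g -> arith (fun n => f n * g n).
Proof.
by move=> [t ft] [u gu]; exists (AMul t u) => n; rewrite -ft -gu.
Qed.

Lemma arith_div f g : arith f -> arith g -> arith (fun n => f n %/ g n).
Proof.
by move=> [t ft] [u gu]; exists (ADiv t u) => n; rewrite -ft -gu.
Qed.

Lemma arith_exp2 f : arith f -> arith (fun n => 2 ^ f n).
Proof. by move=> [t ft]; exists (AExp2 t) => n; rewrite -ft. Qed.

Lemma arith_const c : arith (fun=> c).
Proof.
elim: c => [|c [t ht]]; first by exists (AZero 1).
by exists (AAdd (AOne 1) t) => n; rewrite -(ht n).
Qed.

Lemma arith_mod f g : arith f -> arith g -> arith (fun n => f n %% g n).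
Proof.
move=> af ag; apply: arith_ext (arithB af (arithM (arith_div af ag) ag)) _.
by move=> n /=; rewrite {1}(divn_eq (f n) (g n)) addKn.
Qed.

(* Because 2 ^ L is congruent to x modulo 2 ^ L - x. *)
Lemma expn_mod_exp2 x y L : x ^ y + x < 2 ^ L ->
  2 ^ (L * y) %% (2 ^ L - x) = x ^ y.
Proof.
move=> h; rewrite expnM -modnXm.
have -> : 2 ^ L = x + (2 ^ L - x) by lia.
by rewrite addKn modnDr modnXm modn_small //; lia.
Qed.

Lemma arithX f g : arith f -> arith g -> arith (fun n => f n ^ g n).
Proof.
move=> af ag.
(* This width suffices because [x ^ y <= 2 ^ (x * y)] and [x < 2 ^ x]. *)
have aL : arith (fun n => f n * g n + f n + 1).
  by apply: arithD (arith_const 1); apply: arithD => //; apply: arithM.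
apply: arith_ext (arith_mod (arith_exp2 (arithM aL ag))
  (arithB (arith_exp2 aL) af)) _ => n /=.
apply: expn_mod_exp2; set x := f n; set y := g n.
have h1 : x ^ y <= 2 ^ (x * y).
  case: (posnP y) => [->|y0]; first by rewrite muln0.
  by rewrite expnM leq_exp2r // ltnW // ltn_expl.
have h2 : x < 2 ^ x by rewrite ltn_expl.
rewrite !expnD expn1; have : 0 < 2 ^ (x * y) by rewrite expn_gt0.
by nia.
Qed.

(** * Digit sequences and geometric sums *)

(* The number with digits c 0, c 1, ... (least significant first) in base
   2 ^ w, except that c i may exceed the base. *)
Definition dnum (w N : nat) (c : nat -> nat) : nat :=
  \sum_(i < N) c i * 2 ^ (w * i).

Lemma dnum0 w c : dnum w 0 c = 0.
Proof. exact: big_ord0. Qed.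

Lemma dnumS w N c :
  dnum w N.+1 c = c 0 + 2 ^ w * dnum w N (fun i => c i.+1).
Proof.
rewrite /dnum big_ord_recl muln0 muln1; congr (_ + _).
rewrite big_distrr /=; apply: eq_bigr => i _.
by rewrite /bump /= add1n mulnS expnD mulnCA.
Qed.

Lemma dnum_recr w N c : dnum w N.+1 c = dnum w N c + c N * 2 ^ (w * N).
Proof. exact: big_ord_recr. Qed.

Lemma eq_dnum w N c d :
  (forall i, i < N -> c i = d i) -> dnum w N c = dnum w N d.
Proof. by move=> cd; apply: eq_bigr => i _; rewrite cd. Qed.

Lemma dnumD w N c d :
  dnum w N (fun i => c i + d i) = dnum w N c + dnum w N d.
Proof.
by rewrite /dnum -big_split; apply: eq_bigr => i _; rewrite mulnDl.
Qed.

Lemma dnumZ w N k c : dnum w N (fun i => k * c i) = k * dnum w N c.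
Proof. by rewrite /dnum big_distrr; apply: eq_bigr => i _; rewrite /= mulnA. Qed.

Lemma ltn_dnum w N c : (forall i, i < N -> c i < 2 ^ w) ->
  dnum w N c < 2 ^ (w * N).
Proof.
elim: N => [|N IH] h; first by rewrite dnum0 expn_gt0.
rewrite dnum_recr mulnS expnD.
have := IH (fun i lt => h i (ltnW lt)); have := h N (ltnSn N).
by nia.
Qed.

Lemma dnum_digit w N c k : (forall i, i < N -> c i < 2 ^ w) -> k < N ->
  dnum w N c %/ 2 ^ (w * k) %% 2 ^ w = c k.
Proof.
elim: k N c => [|k IH] [|N] c // h kN; rewrite dnumS.
  by rewrite muln0 divn1 mulnC addnC modnMDl modn_small ?h.
rewrite mulnS expnD divnMA mulnC addnC divnMDl ?expn_gt0 //.
by rewrite (divn_small (h 0 isT)) addn0 IH // => i lt_iN; exact: h.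
Qed.

Lemma dnum_geom w N : (2 ^ w - 1) * dnum w N (fun=> 1) = 2 ^ (w * N) - 1.
Proof.
rewrite expnM !subn1 [in RHS]predn_exp; congr (_ * _).
by apply: eq_bigr => i _; rewrite mul1n expnM.
Qed.

Lemma dnum_arith_geom w N :
  (2 ^ w - 1) * dnum w N id + 2 ^ w * dnum w N (fun=> 1) = N * 2 ^ (w * N).
Proof.
have [k kE] : exists k, 2 ^ w = k.+1.
  by exists (2 ^ w).-1; rewrite prednK ?expn_gt0.
elim: N => [|N IH]; first by rewrite !dnum0 !muln0.
rewrite !dnum_recr /= mulnS expnD.
move: IH; rewrite kE subn1 /= => IH.
by move: IH; set D := dnum _ _ _; set G := dnum _ _ _; set P := 2 ^ _; nia.
Qed.

Lemma arith_dnum_geom b N : arith b -> arith N -> (forall n, 0 < b n) ->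
  arith (fun n => dnum (b n) (N n) (fun=> 1)).
Proof.
move=> ab aN b0.
apply: arith_ext (arith_div (arithB (arith_exp2 (arithM ab aN)) (arith_const 1))
  (arithB (arith_exp2 ab) (arith_const 1))) _ => n /=.
by rewrite -dnum_geom mulKn // subn_gt0 -{1}(expn0 2) ltn_exp2l.
Qed.

Lemma arith_dnum_arith_geom b N : arith b -> arith N -> (forall n, 0 < b n) ->
  arith (fun n => dnum (b n) (N n) id).
Proof.
move=> ab aN b0.
apply: arith_ext (arith_div (arithB (arithM aN (arith_exp2 (arithM ab aN)))
    (arithM (arith_exp2 ab) (arith_dnum_geom ab aN b0)))
  (arithB (arith_exp2 ab) (arith_const 1))) _ => n /=.
by rewrite -dnum_arith_geom addnK mulKn // subn_gt0 -{1}(expn0 2) ltn_exp2l.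
Qed.

(** * Binomial coefficients and gcds as terms *)

Lemma arith_bin f g : arith f -> arith g -> arith (fun n => 'C(f n, g n)).
Proof.
move=> af ag.
have aw : arith (fun n => 2 ^ (f n + 1)).
  exact: arith_exp2 (arithD af (arith_const 1)).
apply: arith_ext (arith_mod (arith_div
  (arithX (arithD (arith_const 1) aw) af) (arithX aw ag)) aw) _ => n /=.
set a := f n; set b := g n.
(* Row [a] of Pascal's triangle sums to [2 ^ a], so its entries fit in digits of width [a + 1]. *)
have lt_bin i : i < a.+1 -> 'C(a, i) < 2 ^ (a + 1).
  move=> lt_ia; apply: (@leq_ltn_trans (2 ^ a)); last by rewrite ltn_exp2l // addn1.
  rewrite -[2]/(1 + 1) expnDn (bigD1 (Ordinal lt_ia)) //=.
  by rewrite !exp1n !muln1 leq_addr.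
have -> : (1 + 2 ^ (a + 1)) ^ a = dnum (a + 1) a.+1 (fun i => 'C(a, i)).
  rewrite expnDn; apply: eq_bigr => i _.
  by rewrite exp1n mul1n expnM.
rewrite -expnM; have [le_ba|lt_ab] := leqP b a; first exact: dnum_digit.
rewrite divn_small ?mod0n ?bin_small //.
by apply: leq_trans (ltn_dnum lt_bin) _; rewrite leq_exp2l // leq_mul2l lt_ab orbT.
Qed.

Lemma sum_exp2_dnum (I : finType) w N (s : I -> nat) :
  (forall i, s i < N) ->
  \sum_i 2 ^ (w * s i) = dnum w N (fun k => \sum_i (s i == k)).
Proof.
move=> sN; under [RHS]eq_bigr do rewrite big_distrl.
rewrite exchange_big; apply: eq_bigr => i _ /=.
rewrite (bigD1 (Ordinal (sN i))) //= eqxx mul1n big1 ?addn0 // => k.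
by rewrite -val_eqE /= eq_sym => /negPf ->.
Qed.

(* With i = p.1 and j = p.2, the equation says a * i.+1 = b * (a - j). *)
Lemma count_lattice_gcd a b : 0 < a -> 0 < b ->
  \sum_(p : 'I_b * 'I_a) (a * p.1 + b * p.2 == a * b - a) = gcdn a b.
Proof.
move=> a0 b0; rewrite -(pair_bigA _ (fun (i : 'I_b) (j : 'I_a) => (a * i + b * j == a * b - a)  : nat)) /=.
have g0 : 0 < gcdn a b by rewrite gcdn_gt0 a0.
(* The gcd becomes the number of multiples of [b %/ gcdn a b] among 1, ..., [b], to be matched with
   the indices [i.+1]. *)
have -> : gcdn a b = b %/ (b %/ gcdn a b).
  by rewrite divnA ?dvdn_gcdr // mulKn.
rewrite divn_count_dvd big_add1 big_mkord; apply: eq_bigr => i _.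
have -> : (b %/ gcdn a b %| i.+1) = (b %| a * i.+1).
  rewrite -(@dvdn_pmul2r (gcdn a b)) // divnK ?dvdn_gcdr //.
  by rewrite muln_gcdr dvdn_gcd [b %| _ * b]dvdn_mull // andbT mulnC.
have lt_ib := ltn_ord i.
have [/dvdnP[q hq]|ndv] := boolP (b %| _).
  have qa : q <= a by nia.
  have lt_qa : a - q < a by nia.
  rewrite (bigD1 (Ordinal lt_qa)) //= big1 ?addn0 => [|j].
    by have -> : a * i + b * (a - q) == a * b - a by nia.
  rewrite -val_eqE /= => hj; have lt_ja := ltn_ord j.
  have [e|//] := eqVneq; exfalso.
  by move/eqP: hj; nia.
rewrite big1 // => j _; have [e|//] := eqVneq.
have lt_ja := ltn_ord j.
case/negP: ndv; apply/dvdnP; exists (a - j); nia.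
Qed.

(** With [a = f n], [b = g n] and [w = a * b], a product of two geometric sums has one term
    [2 ^ (w * (a * i + b * j))] per lattice point. A digit counts at most [a * b < 2 ^ w] points, so
    the digit at [a * b - a] can be read off. *)
Lemma arith_gcdn f g : arith f -> arith g ->
  (forall n, 0 < f n) -> (forall n, 0 < g n) ->
  arith (fun n => gcdn (f n) (g n)).
Proof.
move=> af ag f0 g0.
have aw := arithM af ag.
have w0 n : 0 < f n * g n by rewrite muln_gt0 f0 g0.
have afg : arith (fun n => dnum (f n * g n * f n) (g n) (fun=> 1) *
                           dnum (f n * g n * g n) (f n) (fun=> 1)).
  by apply: arithM; apply: arith_dnum_geom => // [|n]; rewrite ?muln_gt0 ?w0 ?f0 ?g0 //;
    apply: arithM.
apply: arith_ext (arith_mod (arith_div afg (arith_exp2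
  (arithM aw (arithB aw af)))) (arith_exp2 aw)) _ => n /=.
have a0 := f0 n; have b0 := g0 n; set a := f n in a0 *; set b := g n in b0 *.
have -> : dnum (a * b * a) b (fun=> 1) * dnum (a * b * b) a (fun=> 1) =
    \sum_(p : 'I_b * 'I_a) 2 ^ (a * b * (a * p.1 + b * p.2)).
  rewrite big_distrlr pair_bigA; apply: eq_bigr => p _ /=.
  by rewrite !mul1n -expnD -!mulnA -!mulnDr.
rewrite (@sum_exp2_dnum _ _ (a * b + a * b)) => [|[i j] /=]; last first.
  by have := ltn_ord i; have := ltn_ord j; nia.
rewrite dnum_digit; first exact: count_lattice_gcd.
  move=> k _; apply: (@leq_ltn_trans (a * b)); last exact: ltn_expl.
  apply: (@leq_trans (\sum_(p : 'I_b * 'I_a) 1)).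
    by apply: leq_sum => p _; apply: leq_b1.
  by rewrite sum1_card card_prod !card_ord mulnC.
by nia.
Qed.

(** * The 2-adic valuation as a term *)

Lemma gcdn_exp2_logn a : 0 < a -> gcdn a (2 ^ a) = 2 ^ logn 2 a.
Proof.
move=> a0; have [o co aE] := pfactor_coprime (isT : prime 2) a0.
have va : logn 2 a <= a by apply/ltnW/ltn_logl.
rewrite {1}aE -{2}(subnK va) expnD -muln_gcdl.
suff -> : gcdn o (2 ^ (a - logn 2 a)) = 1 by rewrite mul1n.
by apply/eqP; rewrite -/(coprime _ _) coprimeXr // coprime_sym.
Qed.

(** Only the first two terms of the binomial expansion survive modulo [t ^ 2]. *)
Lemma expn_mod_sqr t v : 1 + v * t < t ^ 2 -> (1 + t) ^ v %% t ^ 2 = 1 + v * t.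
Proof.
move=> lt_vt; rewrite -(modn_small lt_vt).
elim: v {lt_vt} => [//|v IH].
rewrite expnSr -modnMml IH modnMml.
have -> : (1 + v * t) * (1 + t) = v * t ^ 2 + (1 + v.+1 * t) by nia.
by rewrite modnMDl.
Qed.

(* Since 2 ^ K = 1 + t, the residue of (2 ^ v) ^ K = (1 + t) ^ v modulo t ^ 2
   is 1 + v * t, from which v is read off; the summand 1 - f n only replaces
   the value 0, for which logn 2 is 0, by 1. *)
Lemma arith_logn2 f : arith f -> arith (fun n => logn 2 (f n)).
Proof.
move=> af; pose h n := f n + (1 - f n).
have ah : arith h by apply: arithD (arithB (arith_const 1) af).
have h0 n : 0 < h n by rewrite /h; lia.
have au := arith_gcdn ah (arith_exp2 ah) h0 (fun n => expn_gt0 2 (h n)).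
(* [K = h n + 2] makes [t] exceed the valuation [v] by enough for [1 + v * t < t ^ 2]. *)
have aK := arithD ah (arith_const 2).
have at_ := arithB (arith_exp2 aK) (arith_const 1).
apply: arith_ext (arith_div (arithB (arith_mod (arithX au aK)
  (arithX at_ (arith_const 2))) (arith_const 1)) at_) _ => n /=.
have -> : logn 2 (f n) = logn 2 (h n).
  by rewrite /h; case: (f n) => [|m]; rewrite ?logn0 ?logn1 // subSS sub0n addn0.
rewrite gcdn_exp2_logn //; have a0 := h0 n; set a := h n in a0 *.
have va : logn 2 a < a by apply: ltn_logl.
have lt_K : a + 2 < 2 ^ (a + 2) by apply: ltn_expl.
set t := 2 ^ (a + 2) - 1.
have tE : 2 ^ (a + 2) = 1 + t by rewrite /t; lia.
have le_t : a + 2 <= t by rewrite /t; lia.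
rewrite -expnM mulnC expnM tE expn_mod_sqr; last by nia.
by rewrite addKn mulnK //; lia.
Qed.

(** * Binary digit sums and Kummer's theorem for the prime 2 *)

(* By Legendre's formula, the number of ones in the binary expansion of n. *)
Definition hw (n : nat) : nat := n - logn 2 n`!.

Lemma logn2_fact_double m : logn 2 (m.*2)`! = m + logn 2 m`!.
Proof.
elim: m => [|m IH] //; rewrite doubleS !factS.
have odd1 : logn 2 (m.*2).+1 = 0.
  by rewrite logn_coprime // coprime2n /= odd_double.
rewrite !lognM ?muln_gt0 ?fact_gt0 // odd1 IH.
by rewrite -doubleS -mul2n lognM //= (pfactorK 1) //; lia.
Qed.

Lemma logn2_factS_double m : logn 2 (m.*2.+1)`! = m + logn 2 m`!.
Proof.
rewrite factS lognM ?fact_gt0 // logn2_fact_double logn_coprime //.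
by rewrite coprime2n /= odd_double.
Qed.

Lemma logn2_fact_le n : logn 2 n`! <= n.
Proof.
elim/ltn_ind: n => n IH; rewrite -{1}(odd_double_half n).
have [->|n0] := posnP n; first by [].
have := IH n./2; case: (odd n) (odd_double_half n) => /= e;
  rewrite ?logn2_fact_double ?add1n ?add0n ?logn2_factS_double; lia.
Qed.

Lemma hwK n : logn 2 n`! + hw n = n.
Proof. by rewrite subnKC // logn2_fact_le. Qed.

Lemma hw_double (b : bool) m : hw (b + m.*2) = b + hw m.
Proof.
have := hwK m; have := hwK (b + m.*2).
case: b; rewrite ?add1n ?add0n ?logn2_factS_double ?logn2_fact_double; lia.
Qed.

Lemma hw_cat s r m : r < 2 ^ s -> hw (r + 2 ^ s * m) = hw r + hw m.
Proof.
elim: s r m => [|s IH] r m; first by rewrite expn0 mul1n; case: r.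
rewrite expnS => lt_r; have rE := odd_double_half r.
have -> : r + 2 * 2 ^ s * m = odd r + (r./2 + 2 ^ s * m).*2 by lia.
rewrite hw_double IH; last by lia.
by rewrite addnA -hw_double rE.
Qed.

Lemma hw_exp2 q : hw (2 ^ q) = 1.
Proof. by have := @hw_cat q 0 1 (expn_gt0 2 q); rewrite add0n muln1. Qed.

Lemma hw_dnum w N c : (forall i, i < N -> c i < 2 ^ w) ->
  hw (dnum w N c) = \sum_(i < N) hw (c i).
Proof.
elim: N c => [|N IH] c h; first by rewrite dnum0 big_ord0.
by rewrite dnumS hw_cat ?h // IH ?big_ord_recl // => i lt_iN; exact: h.
Qed.

Lemma kummer2 a b : logn 2 'C(a + b, a) + hw (a + b) = hw a + hw b.
Proof.
have := congr1 (logn 2) (bin_fact (leq_addr b a)).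
rewrite addKn !lognM ?muln_gt0 ?fact_gt0 ?bin_gt0 ?leq_addr //.
have := hwK a; have := hwK b; have := hwK (a + b); lia.
Qed.

(** If bit [q] of [d] is clear, adding [2 ^ q] sets it; otherwise one carry moves it to the free
    position [q.+1], and one of the two ones is lost. *)
Lemma hw_carry q d : d < 2 ^ q.+1 ->
  hw d + hw (2 ^ q) = (2 ^ q <= d) + hw (d + 2 ^ q).
Proof.
move=> lt_d; have [le_qd|lt_dq] := leqP.
  have [r rq ->] : exists2 r, r < 2 ^ q & d = r + 2 ^ q * 1.
    by exists (d - 2 ^ q); move: lt_d; rewrite expnS; lia.
  have -> : r + 2 ^ q * 1 + 2 ^ q = r + 2 ^ q * 2 by lia.
  by rewrite !hw_cat // hw_exp2 (hw_exp2 0) (hw_exp2 1); lia.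
have -> : d + 2 ^ q = d + 2 ^ q * 1 by rewrite muln1.
by rewrite hw_cat // hw_exp2 (hw_exp2 0).
Qed.

(** * Three-dimensional arrays of digits *)

(* The digits F x y z in base 2 ^ w, in the lexicographic order of (x, y, z). *)
Definition grid (w Nz Ny Nx : nat) (F : nat -> nat -> nat -> nat) : nat :=
  dnum (w * Nz * Ny) Nx (fun x => dnum (w * Nz) Ny (fun y => dnum w Nz (F x y))).

Lemma eq_grid w Nz Ny Nx F G :
  (forall x y z, x < Nx -> y < Ny -> z < Nz -> F x y z = G x y z) ->
  grid w Nz Ny Nx F = grid w Nz Ny Nx G.
Proof.
move=> FG; apply: eq_dnum => x xN; apply: eq_dnum => y yN.
by apply: eq_dnum => z; apply: FG.
Qed.

Lemma gridD w Nz Ny Nx F G :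
  grid w Nz Ny Nx (fun x y z => F x y z + G x y z) =
  grid w Nz Ny Nx F + grid w Nz Ny Nx G.
Proof.
rewrite /grid -dnumD; apply: eq_dnum => x _; rewrite -dnumD.
by apply: eq_dnum => y _; rewrite dnumD.
Qed.

Lemma gridB w Nz Ny Nx F G :
  (forall x y z, x < Nx -> y < Ny -> z < Nz -> G x y z <= F x y z) ->
  grid w Nz Ny Nx (fun x y z => F x y z - G x y z) =
  grid w Nz Ny Nx F - grid w Nz Ny Nx G.
Proof.
move=> GF; set H := fun _ _ _ => _.
have -> : grid w Nz Ny Nx F = grid w Nz Ny Nx (fun x y z => G x y z + H x y z).
  by apply: eq_grid => x y z xN yN zN; rewrite subnKC ?GF.
by rewrite gridD addKn.
Qed.

(** Separable digits reduce the triple sum to one-dimensional sums with closed forms. *)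
Lemma grid_prod w Nz Ny Nx k u v t :
  grid w Nz Ny Nx (fun x y z => k * (u x * (v y * t z))) =
  k * (dnum (w * Nz * Ny) Nx u * (dnum (w * Nz) Ny v * dnum w Nz t)).
Proof.
set T := dnum w Nz t; set V := dnum _ Ny v.
transitivity (k * T * V * dnum (w * Nz * Ny) Nx u); last by lia.
rewrite -dnumZ; apply: eq_dnum => x _.
transitivity (k * u x * T * V); last by lia.
rewrite -dnumZ; apply: eq_dnum => y _.
transitivity (k * u x * v y * T); last by lia.
by rewrite -dnumZ; apply: eq_dnum => z _; rewrite !mulnA.
Qed.

Lemma hw_grid w Nz Ny Nx F :
  (forall x y z, x < Nx -> y < Ny -> z < Nz -> F x y z < 2 ^ w) ->
  hw (grid w Nz Ny Nx F) =
  \sum_(x < Nx) \sum_(y < Ny) \sum_(z < Nz) hw (F x y z).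
Proof.
move=> Fw.
have Fz x y : x < Nx -> y < Ny -> dnum w Nz (F x y) < 2 ^ (w * Nz).
  by move=> xN yN; apply: ltn_dnum => z zN; apply: Fw.
rewrite hw_dnum => [|x xN]; last by apply: ltn_dnum => y yN; apply: Fz.
apply: eq_bigr => x _; rewrite hw_dnum => [|y yN]; last exact: Fz.
by apply: eq_bigr => y _; rewrite hw_dnum // => z zN; apply: Fw.
Qed.

(** Base [2 ^ q.+2] leaves room for [F x y z + 2 ^ q], so no carry leaves a digit and [kummer2] can
    be evaluated digit by digit with [hw_carry]. *)
Lemma logn2_bin_grid q Nz Ny Nx F :
  (forall x y z, x < Nx -> y < Ny -> z < Nz -> F x y z < 2 ^ q.+1) ->
  let X := grid q.+2 Nz Ny Nx F in
  let Y := grid q.+2 Nz Ny Nx (fun _ _ _ => 2 ^ q) in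
  logn 2 'C(X + Y, X) =
  \sum_(x < Nx) \sum_(y < Ny) \sum_(z < Nz) (2 ^ q <= F x y z).
Proof.
move=> Fq X Y; have := kummer2 X Y.
have q2 : 2 ^ q < 2 ^ q.+2 by rewrite ltn_exp2l.
rewrite {2}/X {2}/Y -gridD !hw_grid // => [||x y z xN yN zN].
- rewrite -big_split; under [X in _ = X -> _]eq_bigr do rewrite -big_split.
  under [X in _ = X -> _]eq_bigr do under eq_bigr do rewrite -big_split /=.
  under [X in _ = X -> _]eq_bigr do under eq_bigr do under eq_bigr do
    rewrite hw_carry ?Fq ?ltn_ord //.
  under [X in _ = X -> _]eq_bigr do under eq_bigr do rewrite big_split /=.
  under [X in _ = X -> _]eq_bigr do rewrite big_split /=.
  by rewrite big_split => /addIn.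
- by move=> x y z xN yN zN; apply: ltn_trans (Fq _ _ _ xN yN zN) _; rewrite ltn_exp2l.
by have := Fq _ _ _ xN yN zN; rewrite !expnS; lia.
Qed.

(** * The weighted count of pairs and its valuation *)

Lemma sum_ltn N k : \sum_(z < N) (z < k) = minn k N.
Proof.
elim: N => [|N IH]; first by rewrite big_ord0 minn0.
by rewrite big_ord_recr IH /=; lia.
Qed.

Definition pair_weight (n d y : nat) : nat :=
  if d * y < n then 2 ^ n.+1 else if d * y == n then 2 ^ d else 0.

(** If [d * y] differs from [n], the two sides shift by at least [2 ^ n.+1], which exceeds [z] and
    is at least [2 ^ d]; equality leaves [z < 2 ^ d]. *)
Lemma count_pair_weight n d y : d <= n ->
  \sum_(z < 2 ^ n.+1) (z + 2 ^ n.+1 * (d * y) < 2 ^ n.+1 * n + 2 ^ d) =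
  pair_weight n d y.
Proof.
move=> dn; rewrite /pair_weight.
have le_d : 2 ^ d <= 2 ^ n.+1 by rewrite leq_exp2l // ltnW.
have d0 : 0 < 2 ^ d by rewrite expn_gt0.
move: (2 ^ n.+1) (2 ^ d) (d * y) le_d d0 => W D e DW D0.
have sumE k : (forall z, z < W -> (z + W * e < W * n + D) = (z < k)) ->
    \sum_(z < W) (z + W * e < W * n + D) = minn k W.
  by move=> h; rewrite -sum_ltn; apply: eq_bigr => z _; rewrite h.
case: ltngtP => [lt_e|gt_e|e_n].
- by rewrite (sumE W) ?minnn // => z zW; rewrite zW; nia.
- by rewrite (sumE 0) ?min0n // => z zW; nia.
by rewrite (sumE D) ?(minn_idPl _) // => z zW; rewrite e_n; lia.
Qed.

(** The pair [(p, n %/ p)] weighs [2 ^ p]. Any other weight is a multiple of [2 ^ p.+1]: it is 0, or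
    [2 ^ n.+1] with [p <= n], or [2 ^ d] for a divisor [d > p]. *)
Lemma logn2_sum_pair_weight n : 1 < n ->
  logn 2 (\sum_(x < n - 1) \sum_(y < n.+1) pair_weight n x.+2 y) = pdiv n.
Proof.
move=> n1; set p := pdiv n.
have p1 : 1 < p by apply/prime_gt1/pdiv_prime.
have pn : p <= n by apply: pdiv_leq; lia.
have dvdW d y : p < d -> 2 ^ p.+1 %| pair_weight n d y.
  move=> pd; rewrite /pair_weight.
  by do 2?case: ifP => _; rewrite ?dvdn0 // dvdn_exp2l.
have dvdW' d y : 1 < d -> (d < p \/ d * y != n) -> 2 ^ p.+1 %| pair_weight n d y.
  move=> d1 h; rewrite /pair_weight; case: ifP => _; first by rewrite dvdn_exp2l.
  case: eqP => [e|_]; last exact: dvdn0.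
  case: h => [dp|/eqP //].
  have : p <= d by apply: pdiv_min_dvd => //; rewrite -e dvdn_mulr.
  by lia.
have lt_x : p - 2 < n - 1 by lia.
have e2 : (p - 2).+2 = p by lia.
have yp : p * (n %/ p) = n by rewrite mulnC divnK ?pdiv_dvd.
have lt_y : n %/ p < n.+1 by rewrite ltnS leq_div.
rewrite (bigD1 (Ordinal lt_x)) //= (bigD1 (Ordinal lt_y)) //= e2.
rewrite {1}/pair_weight yp ltnn eqxx -addnA.
set R := (X in 2 ^ p + X).
have /dvdnP[k ->] : 2 ^ p.+1 %| R.
  apply: dvdn_add; apply: dvdn_sum; [move=> y hne|move=> x hne].
    apply: dvdW' => //; right; apply: contra hne => /eqP e.
    by rewrite -val_eqE /= -(eqn_pmul2l (ltnW p1)) e yp.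
  apply: dvdn_sum => y _.
  have := hne; rewrite -val_eqE /= => hx.
  have [h|h] := ltnP p x.+2; first exact: dvdW.
  by apply: dvdW' => //; left; lia.
have -> : 2 ^ p + k * 2 ^ p.+1 = 2 ^ p * (k.*2).+1 by rewrite expnS; lia.
rewrite lognM ?expn_gt0 // pfactorK // logn_coprime ?addn0 //.
by rewrite coprime2n /= odd_double.
Qed.

(** * Assembling the term *)

Lemma arith_grid_prod w Nz Ny Nx k u v t :
  arith k ->
  arith (fun n => dnum (w n * Nz n * Ny n) (Nx n) u) ->
  arith (fun n => dnum (w n * Nz n) (Ny n) v) ->
  arith (fun n => dnum (w n) (Nz n) t) ->
  arith (fun n => grid (w n) (Nz n) (Ny n) (Nx n)
                    (fun x y z => k n * (u x * (v y * t z)))).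
Proof.
move=> ak au av at_.
apply: arith_ext (arithM ak (arithM au (arithM av at_))) _ => n.
by rewrite grid_prod.
Qed.

Lemma arith_sum_pair_weight :
  arith (fun n => \sum_(x < n - 1) \sum_(y < n.+1) pair_weight n x.+2 y).
Proof.
pose N n := n.+1; pose W n := 2 ^ n.+1; pose L n := n - 1.
(* This [q] gives [2 ^ q n = W n * (2 * 2 ^ (n * n))], which bounds both sides of the inequality on
   the whole grid. *)
pose q n := n * n + n + 2; pose w n := (q n).+2.
have aN : arith N.
  by apply: arith_ext (arithD arith_id (arith_const 1)) _ => n; rewrite /N /= addn1.
have aW : arith W by apply: arith_exp2.
have aL : arith L by apply: arithB arith_id (arith_const 1).
have aq : arith q.
  exact: arithD (arithD (arithM arith_id arith_id) arith_id) (arith_const 2).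
have aw : arith w.
  by apply: arith_ext (arithD aq (arith_const 2)) _ => n; rewrite addn2.
have W0 n : 0 < W n by rewrite expn_gt0.
have w1 n : 0 < w n * W n by rewrite muln_gt0 W0.
have w2 n : 0 < w n * W n * N n by rewrite muln_gt0 w1.
have aw1 := arithM aw aW; have aw2 := arithM aw1 aN.
have ax0 := arith_dnum_geom aw2 aL w2.
have ax1 := arith_dnum_arith_geom aw2 aL w2.
(* Absorbing [2 ^ x] into the base leaves a geometric sum. *)
have axe : arith (fun n => dnum (w n * W n * N n) (L n) (fun x => 2 ^ x)).
  apply: arith_ext (arith_dnum_geom (arithD (arith_const 1) aw2) aL _) _ => [n|n].
    by rewrite addn_gt0.
  by apply: eq_bigr => x _; rewrite mul1n mulnDl mul1n expnD.
have ay0 := arith_dnum_geom aw1 aN w1.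
have ay1 := arith_dnum_arith_geom aw1 aN w1.
have az0 := arith_dnum_geom aw aW (fun=> isT).
have az1 := arith_dnum_arith_geom aw aW (fun=> isT).
(* The digit is [P - Q], each part a sum of separable products. The divisor is [x.+2], whence the
   factors 4 and 2; the summand 1 in [Q] turns the strict inequality into [2 ^ q <= P - Q]. *)
pose P n (x y z : nat) := (2 ^ q n + W n * n) * (1 * (1 * 1)) + 4 * (2 ^ x * (1 * 1)).
pose Q n (x y z : nat) := 1 * (1 * (1 * z)) + 1 * (1 * (1 * 1)) +
  (W n * (x * (y * 1)) + 2 * W n * (1 * (y * 1))).
pose g n F := grid (w n) (W n) (N n) (L n) F.
have aP : arith (fun n => g n (P n)).
  apply: arith_ext (arithD (arith_grid_prod (arithD (arith_exp2 aq) (arithM aW arith_id))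
    ax0 ay0 az0) (arith_grid_prod (arith_const 4) axe ay0 az0)) _ => n.
  by rewrite -gridD.
have aQ : arith (fun n => g n (Q n)).
  apply: arith_ext (arithD
    (arithD (arith_grid_prod (arith_const 1) ax0 ay0 az1)
            (arith_grid_prod (arith_const 1) ax0 ay0 az0))
    (arithD (arith_grid_prod aW ax1 ay1 az0)
            (arith_grid_prod (arithM (arith_const 2) aW) ax0 ay1 az0))) _ => n.
  by rewrite -!gridD.
have aY : arith (fun n => g n (fun _ _ _ => 2 ^ q n)).
  apply: arith_ext (arith_grid_prod (arith_exp2 aq) ax0 ay0 az0) _ => n.
  by apply: eq_grid => x y z _ _ _; rewrite !muln1.
have aX := arithB aP aQ.
apply: arith_ext (arith_logn2 (arith_bin (arithD aX aY) aX)) _ => n /=.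
have PE x y z : P n x y z = 2 ^ q n + W n * n + 2 ^ x.+2.
  by rewrite /P !muln1 !expnS; lia.
have QE x y z : Q n x y z = z + 1 + W n * (x.+2 * y) by rewrite /Q; lia.
have qE : 2 ^ q n = W n * (2 * 2 ^ (n * n)).
  by rewrite /W -expnS -expnD; congr (2 ^ _); rewrite /q; lia.
have ltnn : n * n < 2 ^ (n * n) by apply: ltn_expl.
have W1 := W0 n.
have xW x : x < L n -> 2 ^ x.+2 <= W n.
  by move=> xL; rewrite leq_exp2l //; move: xL; rewrite /L; lia.
have QP x y z : x < L n -> y < N n -> z < W n -> Q n x y z <= 2 ^ q n.
  move=> xL yN zW; rewrite QE qE.
  have : x.+2 * y <= n * n by apply: leq_mul; move: xL yN; rewrite /L /N; lia.
  move=> le_e; apply: (@leq_trans (W n * (1 + x.+2 * y))).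
    by rewrite mulnDr muln1 leq_add2r addn1.
  by rewrite leq_mul2l; apply/orP; right; lia.
rewrite /g -gridB => [|x y z xL yN zW]; last first.
  by apply: leq_trans (QP _ _ _ xL yN zW) _; rewrite PE -addnA leq_addr.
rewrite logn2_bin_grid => [|x y z xL yN zW]; last first.
  have lt_q : W n * n + W n < 2 ^ q n.
    have le_n : n <= n * n by case: (n) => // m; rewrite leq_pmull.
    by rewrite qE addnC -mulnS ltn_mul2l W1 /=; lia.
  by rewrite expnS PE QE; have := xW x xL; lia.
apply: eq_bigr => x _; apply: eq_bigr => y _.
rewrite -count_pair_weight; last by have := ltn_ord x; rewrite /L; lia.
apply: eq_bigr => z _; congr (nat_of_bool _).
have := QP x y z (ltn_ord x) (ltn_ord y) (ltn_ord z).
rewrite PE QE -/(W n); move: (2 ^ q n) (W n * _) (W n * n) (2 ^ x.+2) => a b c d.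
by move: (nat_of_ord z) => k; lia.
Qed.

Theorem mainTheorem2 :
  exists T : aterm 1,
    (forall n : nat, aeval1 T n %| n) /\
    (forall n : nat, composite n -> 1 < aeval1 T n < n).
Proof.
(* The summand [2 - n] vanishes for [n > 1]. At [n = 1] the empty sum has valuation 0, and the
   summand corrects the value to 1. *)
have [T TE] : arith (fun n =>
    logn 2 (\sum_(x < n - 1) \sum_(y < n.+1) pair_weight n x.+2 y) + (2 - n)).
  exact: arithD (arith_logn2 arith_sum_pair_weight) (arithB (arith_const 2) arith_id).
have Tpdiv n : 1 < n -> aeval1 T n = pdiv n.
  by move=> n1; rewrite TE logn2_sum_pair_weight // (eqP n1) addn0.
exists T; split=> [[|[|n]]|n /andP[n1 np]].
- exact: dvdn0.
- by rewrite TE big_ord0.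
- by rewrite Tpdiv // pdiv_dvd.
rewrite Tpdiv // prime_gt1 ?pdiv_prime //= ltn_neqAle pdiv_leq ?(ltnW n1) // andbT.
by apply: contra np => /eqP pn; rewrite -pn pdiv_prime.
Qed.
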